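(* Let $f:\mathbb{R}^n\to\mathbb{R}$ be continuously differentiable and bounded below, let $w_0\in\mathbb{R}^n$, and assume that the level set $\mathcal{L}_0:=\{w\in\mathbb{R}^n: f(w)\le f(w_0)\}$ is compact. Let $c,\delta,\xi\in(0,1)$ and $\eta_{0,0}>0$. Let $\{w_k\}_{k\ge0}$ be an infinite sequence generated by gradient descent $w_{k+1}=w_k-\eta_k\nabla f(w_k)$, where $\eta_k$ is the step size returned by the equality line search at $w_k$ along $-\nabla f(w_k)$ with parameters $c,\delta$, initial step size $\eta_{k,0}$ (with $\eta_{k+1,0}=\eta_k$), and the Zhang–Hager nonmonotone reference value $R_k$ with parameter $\xi$. Then $$\lim_{k\to\infty}\|\nabla f(w_k)\|=0 .$$
   Context: Zhang–Hager reference value with parameter $\xi\in(0,1)$: $R_0=f(w_0)$, $Q_0=1$, $Q_{k+1}=\xi Q_k+1$, and for $k\ge1$ $$R_k=\frac{\xi Q_k R_{k-1}+f(w_k)}{Q_{k+1}} .$$ Equality line search. Inputs: $w_k,d_k\in\mathbb{R}^n$, $c,\delta\in(0,1)$, $\eta_{k,0}>0$, and $R_k$ (here $d_k=-\nabla f(w_k)$). A step size $\eta$ is accepted if $f(w_k+\eta d_k)\le R_k+c\,\eta\,\nabla f(w_k)^Td_k$. If $\eta_{k,0}$ is not accepted, test $\delta\eta_{k,0},\delta^2\eta_{k,0},\dots$ and return the first accepted value. If $\eta_{k,0}$ is accepted, test $\delta^{-1}\eta_{k,0},\delta^{-2}\eta_{k,0},\dots$ until the first value $\delta^{-m}\eta_{k,0}$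 that is not accepted, and return $\delta^{-m+1}\eta_{k,0}$. The method stops if $\nabla f(w_k)=0$, so for an infinite sequence $\nabla f(w_k)\ne0$ for all $k$. *)

(* Defs.v *)
From mathcomp Require Import all_boot all_order all_algebra.
From mathcomp Require Import all_classical all_reals all_analysis.

Set Implicit Arguments.
Unset Strict Implicit.
Unset Printing Implicit Defensive.

Import Order.TTheory GRing.Theory Num.Theory.
Import numFieldNormedType.Exports.

Local Open Scope classical_set_scope.
Local Open Scope ring_scope.

Definition dotp (R : realType) (n : nat) (u v : 'rV[R]_n) : R :=
  \sum_(i < n) u 0 i * v 0 i.

(* The library norm on ['rV[R]_n] is the sup norm; this is the Euclidean one. *)
Definition enorm (R : realType) (n : nat) (u : 'rV[R]_n) : R :=
  Num.sqrt (dotp u u).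

Definition grad (R : realType) (n : nat) (f : 'rV[R]_n -> R) (x : 'rV[R]_n) :
    'rV[R]_n :=
  \row_(i < n) 'D_(delta_mx 0 i) f x.

Definition continuously_differentiable (R : realType) (n : nat)
    (f : 'rV[R]_n -> R) : Prop :=
  (forall x, differentiable f x) /\ continuous (grad f).

Fixpoint zh_Q (R : realType) (xi : R) (k : nat) : R :=
  if k is j.+1 then xi * zh_Q xi j + 1 else 1.

(* [u k] stands for [f (w k)].  The weight of the previous reference value is
   [xi * Q_k / Q_{k+1}], one index later than in Zhang and Hager's original
   recursion, which has [xi * Q_{k-1} / Q_k]. *)
Fixpoint zh_R (R : realType) (xi : R) (u : nat -> R) (k : nat) : R :=
  if k is j.+1 then
    (xi * zh_Q xi k * zh_R xi u j + u k) / zh_Q xi k.+1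
  else u 0%N.

Definition accepted (R : realType) (n : nat) (f : 'rV[R]_n -> R)
    (w d : 'rV[R]_n) (c r eta : R) : bool :=
  f (w + eta *: d) <= r + c * eta * dotp (grad f w) d.

(* The search is given by its input-output relation: [eta] is returned from the
   initial step [eta0].  If the search does not terminate, no [eta] is related
   to the inputs. *)
Definition equality_line_search (R : realType) (n : nat) (f : 'rV[R]_n -> R)
    (w d : 'rV[R]_n) (c delta eta0 r eta : R) : Prop :=
  let acc := accepted f w d c r in
  if acc eta0 then
    exists m : nat,
      [/\ (0 < m)%N,
          forall j : nat, (0 < j < m)%N -> acc (delta ^- j * eta0),
          ~~ acc (delta ^- m * eta0)
        & eta = delta ^- m.-1 * eta0]
  else
    exists m : nat,
      [/\ (0 < m)%N,
          forall j : nat, (0 < j < m)%N -> ~~ acc (delta ^+ j * eta0),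
          acc (delta ^+ m * eta0)
        & eta = delta ^+ m * eta0].

(* Main.v *)
(* In both branches of the search the returned step [eta_k] is accepted while
   [eta_k / delta] is rejected.  Acceptance, with [Q_k <= 1 / (1 - xi)], gives
   [R_{k+1} <= R_k - c (1 - xi) eta_k |g_k|^2]; as [R_k] is bounded below,
   [eta_k |g_k|^2] tends to 0.  Rejection, with [f (w_k) <= R_k] and the mean
   value theorem, gives a [t < eta_k / delta] with
   [(g_k - grad f (w_k - t g_k)) . g_k > (1 - c) |g_k|^2].  The gradient is
   uniformly continuous near the compact level set, which contains all [w_k], so
   [|g_k| >= e] bounds [t |g_k|], hence [eta_k |g_k|^2], away from 0. *)

Require Import Defs.
From mathcomp Require Import all_boot all_order all_algebra.
From mathcomp Require Import all_classical all_reals all_analysis.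
From mathcomp Require Import ring lra.

Set Implicit Arguments.
Unset Strict Implicit.
Unset Printing Implicit Defensive.

Import Order.TTheory GRing.Theory Num.Theory.
Import numFieldNormedType.Exports.

Local Open Scope classical_set_scope.
Local Open Scope ring_scope.

Lemma dotpNr (R : realType) (n : nat) (u v : 'rV[R]_n) :
  dotp u (- v) = - dotp u v.
Proof. by rewrite /dotp -sumrN; apply: eq_bigr => i _; rewrite mxE mulrN. Qed.

Lemma dotpBl (R : realType) (n : nat) (u v x : 'rV[R]_n) :
  dotp (u - v) x = dotp u x - dotp v x.
Proof.
by rewrite /dotp -sumrB; apply: eq_bigr => i _; rewrite !mxE mulrBl.
Qed.

Lemma ler_entry_norm (R : realType) (n : nat) (u : 'rV[R]_n) (i : 'I_n) :
  `|u 0 i| <= `|u|.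
Proof.
rewrite (mx_normrE u : `|u| = _).
exact: (le_bigmax_cond _ (fun ij => `|u ij.1 ij.2|) (isT : xpredT (0, i))).
Qed.

(** Sup-norm substitute for Cauchy-Schwarz: each of the [n] products is at most [|u| * |v|]. *)
Lemma dotp_le_norm (R : realType) (n : nat) (u v : 'rV[R]_n) :
  dotp u v <= n%:R * (`|u| * `|v|).
Proof.
apply: (@le_trans _ _ (\sum_(i < n) `|u| * `|v|)); last first.
  by rewrite sumr_const card_ord mulr_natl.
apply: ler_sum => i _; apply: le_trans (ler_norm _) _.
by rewrite normrM ler_pM ?ler_entry_norm.
Qed.

Lemma sqr_norm_le_dotp (R : realType) (n : nat) (u : 'rV[R]_n) :
  `|u| ^+ 2 <= dotp u u.
Proof.
have dotp_ge0 : 0 <= dotp u u by apply: sumr_ge0 => i _; rewrite -expr2 sqr_ge0.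
rewrite -[leRHS]sqr_sqrtr// ler_pXn2r ?nnegrE ?sqrtr_ge0//.
rewrite (mx_normrE u : `|u| = _).
apply: bigmax_le => [|[i j] _ /=]; first exact: sqrtr_ge0.
rewrite ord1 -sqrtr_sqr ler_wsqrtr// /dotp (bigD1 j)//= -expr2 lerDl.
by apply: sumr_ge0 => k _; rewrite -expr2 sqr_ge0.
Qed.

Lemma enorm_le_norm (R : realType) (n : nat) (u : 'rV[R]_n) :
  enorm u <= n%:R * `|u|.
Proof.
rewrite -[leRHS]ger0_norm ?mulr_ge0// -sqrtr_sqr ler_wsqrtr//.
apply: le_trans (dotp_le_norm u u) _; rewrite exprMn -expr2.
apply: ler_wpM2r; first exact: sqr_ge0.
by rewrite -natrX ler_nat; case: (n) => // m; rewrite leq_pmulr.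
Qed.

Lemma derive_dotp_grad (R : realType) (n : nat) (f : 'rV[R]_n -> R)
    (x v : 'rV[R]_n) :
  differentiable f x -> 'D_v f x = dotp (grad f x) v.
Proof.
move=> fx; rewrite deriveE// [in LHS](row_sum_delta v) linear_sum.
by apply: eq_bigr => i _; rewrite linearZ mxE deriveE// mulrC.
Qed.

(** The difference quotient of the restriction at [t] is that of [f] at [x + t *: v] in direction
    [v]. *)
Lemma is_derive_line (R : realType) (n : nat) (f : 'rV[R]_n -> R)
    (x v : 'rV[R]_n) (t : R) :
  differentiable f (x + t *: v) ->
  is_derive t 1 (fun s => f (x + s *: v)) (dotp (grad f (x + t *: v)) v).
Proof.
move=> fx; rewrite -derive_dotp_grad//.
have E : (fun h => h^-1 *: (((fun s => f (x + s *: v)) \o shift t) (h *: 1)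
            - f (x + t *: v))) =
         (fun h => h^-1 *: ((f \o shift (x + t *: v)) (h *: v)
            - f (x + t *: v))).
  apply/funext => h /=; congr (_ *: (f _ - _)).
  by rewrite [h *: 1]mulr1 scalerDl addrCA.
split; last by rewrite /derive E.
by rewrite /derivable E; apply: diff_derivable.
Qed.

Lemma line_mean_value (R : realType) (n : nat) (f : 'rV[R]_n -> R)
    (x v : 'rV[R]_n) (a : R) :
  (forall y, differentiable f y) -> 0 < a ->
  exists2 t, 0 < t < a &
    f (x + a *: v) - f x = a * dotp (grad f (x + t *: v)) v.
Proof.
move=> df a0.
have D (t : R) := @is_derive_line R n f x v t (df _).
have cont : {within `[0, a], continuous (fun s : R => f (x + s *: v))}.
  apply: continuous_subspaceT => t.
  by apply: differentiable_continuous; apply/derivable1_diffP; case: (D t).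
have [t t0a] := MVT a0 (fun t _ => D t) cont.
rewrite scale0r addr0 subr0 mulrC => e.
by exists t => //; move: t0a; rewrite in_itv.
Qed.

(** Only [x] is confined to [K], since the intermediate point given by the mean value theorem may
    leave the level set. The near-covering form of compactness turns local radii into one [d]. *)
Lemma compact_uniformly_continuous (R : realType) (V W : normedModType R)
    (K : set V) (g : V -> W) (e : R) :
  compact K -> continuous g -> 0 < e ->
  exists2 d, 0 < d &
    forall x y, K x -> `|x - y| < d -> `|g x - g y| < e.
Proof.
move=> /compact_near_coveringP Kc cg e0.
have H : \forall d \near (0 : R)^'+,
    K `<=` [set x | forall y, `|x - y| < d -> `|g x - g y| < e].
  apply: (Kc R (0 : R)^'+
    (fun d x => forall y, `|x - y| < d -> `|g x - g y| < e)) => x Kx.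
  have /cvgrPdist_lt/(_ (e / 2)) := cg x.
  rewrite divr_gt0// => /(_ isT) /nbhs_normP [r /= r0 gr].
  (* With [z] within [r / 2] of [x] and [y] within [r / 2] of [z], both lie in the ball where [g]
     stays within [e / 2] of [g x]. *)
  exists (ball x (r / 2), [set d | d < r / 2]); first split => /=.
  - by apply: nbhsx_ballx; rewrite divr_gt0.
  - by apply: nbhs_right_lt; rewrite divr_gt0.
  case=> z d /= [xz dr] y zy.
  have hz : `|x - z| < r / 2 by move: xz; rewrite -ball_normE.
  have -> : g z - g y = (g x - g y) - (g x - g z).
    by rewrite opprB [RHS]addrC subrKA.
  rewrite (le_lt_trans (ler_normB _ _))// (splitr e) ltrD//; apply: gr => /=.
    rewrite -[x - y](subrKA z) (le_lt_trans (ler_normD _ _))//.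
    by rewrite (splitr r) ltrD// (lt_trans zy).
  by rewrite (lt_trans hz)// ltr_pdivrMr// mulr_natr mulr2n ltrDl.
have [d [d0 Hd]] := filter_ex (filterI (nbhs_right_gt (0 : R)) H).
by exists d => // x y Kx; apply: Hd.
Qed.

(** Expansion stops just before its first rejection and backtracking just after its last one, so in
    both cases [eta] and [eta / delta] are neighbouring trial steps. *)
Lemma equality_line_searchP (R : realType) (n : nat) (f : 'rV[R]_n -> R)
    (w d : 'rV[R]_n) (c delta eta0 r eta : R) :
  0 < delta -> 0 < eta0 -> equality_line_search f w d c delta eta0 r eta ->
  [/\ 0 < eta, accepted f w d c r eta & ~~ accepted f w d c r (eta / delta)].
Proof.
move=> delta0 eta00; rewrite /equality_line_search.
have deltaN0 : delta != 0 by rewrite gt_eqF.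
case: ifPn => acc0 [] [[]//|m] [_ accj accm ->] /=.
  split; first by rewrite mulr_gt0// invr_gt0 exprn_gt0.
    (* For [m = 0] the returned step is [eta0] itself, outside the range of [accj]; the branch
       condition covers it. *)
    case: m accj {accm} => [|m] accj; first by rewrite expr0 invr1 mul1r.
    by apply: accj; rewrite /= ltnSn.
  by rewrite mulrAC -invfM -exprSr.
split => //; first by rewrite mulr_gt0// exprn_gt0.
rewrite exprSr mulrAC mulfK//.
case: m accj {accm} => [|m] accj; first by rewrite expr0 mul1r.
by apply: accj; rewrite /= ltnSn.
Qed.

Lemma zh_Q_ge1 (R : realType) (xi : R) (k : nat) : 0 < xi -> 1 <= zh_Q xi k.
Proof. by move=> xi0; case: k => //= k; elim: k => /= [|k IH]; nra. Qed.

(** [zh_Q xi k] is the geometric sum [1 + xi + ... + xi ^+ k]. *)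
Lemma zh_Q_le (R : realType) (xi : R) (k : nat) :
  0 < xi < 1 -> (1 - xi) * zh_Q xi k <= 1.
Proof. by move=> xi01; elim: k => /= [|k IH]; nra. Qed.

(** As [xi * Q_{k+1} = Q_{k+2} - 1], the new reference value is the old one moved towards [u k.+1]
    by the fraction [1 / Q_{k+2}]. *)
Lemma zh_RS (R : realType) (xi : R) (u : nat -> R) (k : nat) : 0 < xi ->
  zh_R xi u k.+1 =
    zh_R xi u k - (zh_R xi u k - u k.+1) / zh_Q xi k.+2.
Proof.
move=> xi0; have Q1 := zh_Q_ge1 k.+2 xi0.
have QN0 : zh_Q xi k.+2 != 0 by rewrite gt_eqF//; lra.
have QE : zh_Q xi k.+2 = xi * zh_Q xi k.+1 + 1 by [].
have -> : zh_R xi u k.+1 =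
  (xi * zh_Q xi k.+1 * zh_R xi u k + u k.+1) / zh_Q xi k.+2 by [].
apply: (mulIf QN0); rewrite divfK// mulrBl divfK// QE; ring.
Qed.

Theorem theorem2p9 (R : realType) (n : nat) (f : 'rV[R]_n -> R)
    (w0 : 'rV[R]_n) (c delta xi eta00 : R)
    (w : nat -> 'rV[R]_n) (eta eta_init : nat -> R)
    (f_C1 : continuously_differentiable f)
    (f_bounded_below : exists m : R, forall x : 'rV[R]_n, m <= f x)
    (level_compact : compact [set x : 'rV[R]_n | f x <= f w0])
    (c01 : 0 < c < 1) (delta01 : 0 < delta < 1) (xi01 : 0 < xi < 1)
    (eta00_gt0 : 0 < eta00)
    (w_init : w 0%N = w0)
    (w_step : forall k : nat, w k.+1 = w k - eta k *: grad f (w k))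
    (w_nonstop : forall k : nat, grad f (w k) <> 0)
    (eta_init0 : eta_init 0%N = eta00)
    (eta_initS : forall k : nat, eta_init k.+1 = eta k)
    (eta_search : forall k : nat,
      equality_line_search f (w k) (- grad f (w k)) c delta (eta_init k)
        (zh_R xi (fun j : nat => f (w j)) k) (eta k)) :
  (fun k : nat => enorm (grad f (w k))) @ \oo --> (0 : R).
Proof.
have [df cgrad] := f_C1; have [lo f_lo] := f_bounded_below.
have [c0 c1] := andP c01; have [delta0 delta1] := andP delta01.
have [xi0 xi1] := andP xi01.
set r := zh_R xi (fun j => f (w j)) in eta_search.
pose g k := grad f (w k).
have init_gt0 k : 0 < eta_init k.
  elim: k => [|k IH]; first by rewrite eta_init0.
  by rewrite eta_initS; case: (equality_line_searchP delta0 IH (eta_search k)).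
have search k := equality_line_searchP delta0 (init_gt0 k) (eta_search k).
have eta_gt0 k : 0 < eta k by case: (search k).
have sqr_le k : `|g k| ^+ 2 <= dotp (g k) (g k) := sqr_norm_le_dotp (g k).
have dec_ge0 k : 0 <= eta k * dotp (g k) (g k).
  by rewrite mulr_ge0 ?(ltW (eta_gt0 k))// (le_trans (sqr_ge0 _) (sqr_le k)).
have armijo k : f (w k.+1) <= r k - c * (eta k * dotp (g k) (g k)).
  have [_ + _] := search k.
  by rewrite /accepted dotpNr scalerN -w_step mulrN mulrA.
have rS k : r k.+1 <= r k - c * (1 - xi) * (eta k * dotp (g k) (g k)).
  rewrite /r zh_RS// -/r lerD2l lerN2.
  have Q1 := zh_Q_ge1 k.+2 xi0; have Q2 := zh_Q_le k.+2 xi01.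
  rewrite ler_pdivlMr; last by lra.
  apply: (@le_trans _ _ (c * (eta k * dotp (g k) (g k)))); last first.
    by have := armijo k; lra.
  have cD : 0 <= c * (eta k * dotp (g k) (g k)) by rewrite mulr_ge0// ltW.
  by have := ler_wpM2l cD Q2; lra.
(* The move towards [f (w k.+1)], which is at most [r k], does not overshoot because
   [Q_{k+2} >= 1]. *)
have r_ge k : f (w k) <= r k.
  case: k => // k.
  have Q1 := zh_Q_ge1 k.+2 xi0.
  have fr : f (w k.+1) <= r k.
    by apply: le_trans (armijo k) _; rewrite gerBl mulr_ge0// ltW.
  rewrite /r zh_RS// -/r lerBrDr -lerBrDl.
  by rewrite ler_pdivrMr ?ler_peMr ?subr_ge0//; lra.
have r_noninc : {homo r : i j / (i <= j)%N >-> j <= i}.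
  apply/nonincreasing_seqP => k; apply: le_trans (rS k) _.
  by rewrite gerBl mulr_ge0// mulr_ge0 ?subr_ge0// ltW.
(* The values [f (w k)] may increase, but [r k <= r 0 = f w0] caps them. *)
have w_level k : f (w k) <= f w0.
  by rewrite -w_init (le_trans (r_ge k)) ?(r_noninc 0).
have gap e : 0 < e -> exists2 kappa, 0 < kappa &
    forall k, e <= `|g k| -> kappa <= eta k * dotp (g k) (g k).
  (* Using [n.+1] instead of [n] keeps [s] positive when [n = 0]. *)
  move=> e0; pose s := (1 - c) * e / n.+1%:R.
  have s0 : 0 < s by rewrite divr_gt0// mulr_gt0 ?subr_gt0.
  have [rho rho0 Hrho] := compact_uniformly_continuous level_compact cgrad s0.
  (* This constant arises from [delta * t <= eta k], [rho <= t * |g k|] and [e <= |g k|]. *)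
  exists (delta * rho * e) => [|k ek]; first by rewrite !mulr_gt0.
  have N0 : 0 < `|g k| by exact: lt_le_trans ek.
  have a0 : 0 < eta k / delta by rewrite divr_gt0.
  have [t /andP[t0 ta] mv] := line_mean_value (w k) (- g k) df a0.
  have [_ _] := search k.
  rewrite /accepted -/(g k) -ltNge => rej.
  have slope : c * dotp (g k) (g k) > dotp (grad f (w k + t *: - g k)) (g k).
    have : eta k / delta * (c * dotp (g k) (g k)) >
           eta k / delta * dotp (grad f (w k + t *: - g k)) (g k).
      (* The nonmonotone slack [r k - f (w k) >= 0] only strengthens the rejection inequality. *)
      by move: rej mv (r_ge k); rewrite !dotpNr; lra.
    by rewrite ltr_pM2l.
  (* The factor [n] in [s] pays for using the sup norm instead of the Euclidean
     one in Cauchy-Schwarz. *)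
  have tN : rho <= t * `|g k|.
    rewrite leNgt; apply/negP => tN.
    have := Hrho (w k) (w k + t *: - g k) (w_level k).
    rewrite opprD addNKr normrN normrZ normrN gtr0_norm// => /(_ tN) gs.
    have := dotp_le_norm (g k - grad f (w k + t *: - g k)) (g k).
    rewrite dotpBl leNgt => /negP; apply.
    apply: (@le_lt_trans _ _ (n%:R * (s * `|g k|))).
      by rewrite ler_wpM2l// ler_wpM2r// ltW.
    apply: (@le_lt_trans _ _ ((1 - c) * `|g k| ^+ 2)).
      rewrite expr2 !mulrA ler_wpM2r//.
      apply: (@le_trans _ _ ((1 - c) * e)).
        rewrite ler_pdivrMr// -mulrA mulrC ler_wpM2l ?ler_nat//.
        by rewrite mulr_ge0 ?subr_ge0// ltW.
      by rewrite ler_wpM2l// subr_ge0 ltW.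
    (* By [slope] the right side exceeds [(1 - c) * dotp (g k) (g k)], which dominates the left
       side. *)
    by have := sqr_le k; nra.
  apply: le_trans (_ : eta k * `|g k| ^+ 2 <= _); last first.
    by rewrite ler_wpM2l ?(ltW (eta_gt0 k)).
  have : delta * t <= eta k by move: ta; rewrite ltr_pdivlMr//; lra.
  rewrite expr2 mulrA => H; apply: ler_pM => //.
  - by rewrite mulr_ge0// ltW.
  - exact: ltW.
  apply: le_trans (_ : delta * (t * `|g k|) <= _).
    by rewrite ler_wpM2l// ltW.
  by rewrite mulrA ler_wpM2r.
(* Being nonincreasing and bounded below by [lo], [r] converges, so its consecutive differences
   vanish. *)
have dec_cvg : (fun k => r k - r k.+1) @ \oo --> (0 : R).
  have r_cvg : cvgn r.
    apply: nonincreasing_is_cvgn => //; exists lo => _ [k _ <-].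
    exact: le_trans (r_ge k).
  rewrite -[0](subrr (limn r)); apply: cvgB => //.
  by rewrite (cvg_shiftS r).
have g_cvg : (fun k => `|g k|) @ \oo --> (0 : R).
  (* An index with [|g k| >= e] would make [r] drop by at least [c * (1 - xi) * kappa], which
     eventually cannot happen. *)
  apply/cvgrPdist_lt => e e0; have [kappa kappa0 Hkappa] := gap e e0.
  have ck0 : 0 < c * (1 - xi) * kappa by rewrite !mulr_gt0 ?subr_gt0.
  move/cvgrPdist_lt: dec_cvg => /(_ _ ck0); apply: filterS => k.
  rewrite !sub0r !normrN normr_id => small; rewrite ltNge; apply/negP.
  move=> /Hkappa big; move: small; rewrite ltNge => /negP; apply.
  apply: le_trans (ler_norm _).
  apply: (@le_trans _ _ (c * (1 - xi) * (eta k * dotp (g k) (g k)))).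
    by rewrite ler_pM2l// mulr_gt0// subr_gt0.
  by have := rS k; lra.
(* The factor [n] passes from the sup norm back to the Euclidean norm. *)
have ng_cvg : (fun k => n%:R * `|g k|) @ \oo --> (0 : R).
  by rewrite -[0](mulr0 n%:R); apply: cvgMr.
apply: squeeze_cvgr (@cvg_cst _ 0 _ _ _) ng_cvg.
by apply: nearW => k; rewrite sqrtr_ge0 enorm_le_norm.
Qed.
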